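(* Let $T(p,q)$ denote the $(p,q)$ torus knot, let $J_n=T(4n,(2n-1)^2)$ for $n\ge 2$, and let $K_n=T(4n,(2n+1)^2)$ for $n\ge 0$ (so $K_0=T(0,1)$ is the unknot). Then for every $n\geq 2$, applying a sequence of four pinch moves to $J_n$ yields the knot $K_{n-2}$.
   Context: $T(p,q)$ ($p,q$ relatively prime) is the torus knot on a standardly embedded torus $T^2\subset S^3$; $T(p,q)$ and $T(q,p)$ are the same knot, and $T(0,1)$ is the unknot. A pinch move on $T(p,q)\subset T^2$ is surgery on a pinch band: a (blackboard framed) band between two adjacent strands of the standard diagram of $T(p,q)$, embedded in the same torus $T^2$. (Surgery on a band $b=I\times I$ with $b\cap K=\partial I\times I$ replaces $K$ by $(K\setminus(\partial I\times I))\cup(I\times\partial I)$.) The result is again a torus knot. By a known result of Jabuka and Van Cott, a pinch move applied to $T(p,q)$ yields $T(|p-2t|,|q-2h|)$, where $t$ and $h$ are the smallest nonnegative integers satisfying $t\equiv -q^{-1}\bmod p$ and $h\equiv p^{-1}\bmod q$. The torus knot resulting from a pinch move is therefore uniquely determined. *)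

(* Defs.v *)
From mathcomp Require Export all_boot all_order all_algebra.
From mathcomp Require Export all_classical all_reals all_analysis.
Export numFieldNormedType.Exports.
Export Order.TTheory GRing.Theory Num.Theory.

Set Implicit Arguments.
Unset Strict Implicit.
Unset Printing Implicit Defensive.

Local Open Scope classical_set_scope.
Local Open Scope ring_scope.

(* R^4 = C x C, a point (z, w) being stored as ((Re z, Im z), (Re w, Im w)). *)
Notation R4 R := ((R * R) * (R * R))%type.

Definition S3 (R : realType) : set (R4 R) :=
  [set x | x.1.1 ^+ 2 + x.1.2 ^+ 2 + x.2.1 ^+ 2 + x.2.2 ^+ 2 = 1].
Arguments S3 : clear implicits.

(* The standard torus |z| = |w| in S^3, parametrized by its universal cover
   R^2; two points of R^2 have the same image iff they differ by Z^2. *)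
Definition torus (R : realType) (v : R * R) : R4 R :=
  ((cos (2 * pi * v.1) / Num.sqrt 2, sin (2 * pi * v.1) / Num.sqrt 2),
   (cos (2 * pi * v.2) / Num.sqrt 2, sin (2 * pi * v.2) / Num.sqrt 2)).

(* T(p,q): the image of the line of direction (p, q) through the origin.
   It is a simple closed curve of homology class (p, q) when p and q are
   coprime; coprimality is required where the notation T(p,q) is used. *)
Definition torus_knot (R : realType) (p q : nat) : set (R4 R) :=
  [set torus (p%:R * x, q%:R * x) | x in [set: R]].
Arguments torus_knot : clear implicits.

(* Each stage H t is a continuous bijection of the compact Hausdorff space S^3,
   hence a homeomorphism. *)
Definition ambient_isotopic (R : realType) (K L : set (R4 R)) : Prop :=
  exists H : R -> R4 R -> R4 R,
    [/\ {within `[0, 1]%classic `*` S3 R,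
          continuous (fun z : R * R4 R => H z.1 z.2)},
        forall t : R, 0 <= t <= 1 -> set_bij (S3 R) (S3 R) (H t),
        forall x, S3 R x -> H 0 x = x,
        K `<=` S3 R &
        H 1 @` K = L].

Definition unit_square (R : realType) : set (R * R) :=
  `[0, 1]%classic `*` `[0, 1]%classic.
Arguments unit_square : clear implicits.

(* An embedded band b = I x I whose intersection with K is (boundary I) x I. *)
Definition is_band (R : realType) (K : set (R4 R)) (b : R * R -> R4 R) : Prop :=
  [/\ {within unit_square R, continuous b},
      set_inj (unit_square R) b,
      b @` unit_square R `<=` S3 R &
      forall x, unit_square R x -> (K (b x) <-> x.1 = 0 \/ x.1 = 1)].

Definition band_surgery (R : realType) (K : set (R4 R)) (b : R * R -> R4 R) :
    set (R4 R) :=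
  (K `\` b @` ([set 0; 1] `*` `[0, 1]%classic)) `|`
  b @` (`[0, 1]%classic `*` [set 0; 1]).

(* For p, q coprime, T(p,q) lifts to the union of the lines p y - q x = k, with k
   an integer. A band between adjacent strands crosses the strip between two
   consecutive lines directly: its core is a straight segment d across the strip
   (p d2 - q d1 = 1) and its width is in the direction (p, q) of the strands.
   The condition d1 <= 0 <= d2 says that the core does not run along
   the strands; it allows the orthogonal direction as well as those of the
   meridian and the longitude of the torus, along which strands are adjacent in
   the standard diagram. Without it the band could spiral along the knot before
   reaching the other strand, and surgery could give other curves. *)
Definition pinch_band (R : realType) (p q : nat) (b : R * R -> R4 R) : Prop :=
  is_band (torus_knot R p q) b /\
  exists c d : R * R, exists u : R,
    [/\ p%:R * d.2 - q%:R * d.1 = 1,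
        d.1 <= 0 /\ 0 <= d.2,
        0 < u &
        forall x, unit_square R x ->
          b x = torus (c.1 + x.1 * d.1 + x.2 * (u * p%:R),
                       c.2 + x.1 * d.2 + x.2 * (u * q%:R))].

(* A pinch move applied to K yields L: K is a torus knot T(p,q), pinch bands
   exist, and surgery on T(p,q) along any of them gives L up to isotopy. *)
Definition pinch_move (R : realType) (K L : set (R4 R)) : Prop :=
  exists p q : nat,
    [/\ coprime p q,
        ambient_isotopic K (torus_knot R p q),
        exists b : R * R -> R4 R, pinch_band p q b &
        forall b, pinch_band p q b ->
          ambient_isotopic (band_surgery (torus_knot R p q) b) L].

Definition J_knot (R : realType) (n : nat) : set (R4 R) :=
  torus_knot R (4 * n)%N ((2 * n - 1) ^ 2)%N.
Arguments J_knot : clear implicits.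

Definition K_knot (R : realType) (n : nat) : set (R4 R) :=
  torus_knot R (4 * n)%N ((2 * n + 1) ^ 2)%N.
Arguments K_knot : clear implicits.

(* Main.v *)
Require Import Defs.
From mathcomp Require Import ring lra zify.

(* Write q = p m + 1. In the coordinates b = p y - q x, s = y - m x of R^2/Z^2 the
   knot T(p,q) is the circle b = 0, and a pinch band based at the origin has the
   parallel edges from (0,0) to (1,s0) and from (0,u) to (1,s0+u); embeddedness
   forces u < s0 <= 1/2. Surgery yields the closed zigzag
   (0,0) -> (1,s0) -> (1,u) -> (2,s0+u) -> (2,1), homotopic to the line b = 2 s,
   which is T(p-2,q-2m). Three shears b += f(s), s += k(b), b += h(s) with
   1-periodic f, k, h straighten it: f tilts the two pieces contained in b = const,
   k then makes s increase along the whole curve, and h straightens the graph thus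
   obtained. A shear of the torus along a circle subgroup extends to an ambient
   isotopy of S^3. Finally (2n-1)^2 = 4n(n-1) + 1, so this applies four times with
   m = n - 1. *)

Set Implicit Arguments.
Unset Strict Implicit.
Unset Printing Implicit Defensive.
Local Open Scope classical_set_scope.
Local Open Scope ring_scope.

(** * Continuity and circle arithmetic *)


Section ContinuousMaps.
Variables (R : realType) (T : topologicalType).
Implicit Types f g : T -> R.

Lemma continuous_pair (U V : topologicalType) (f : T -> U) (g : T -> V) :
  continuous f -> continuous g -> continuous (fun x => (f x, g x)).
Proof. by move=> cf cg x; apply: cvg_pair; [exact: cf|exact: cg]. Qed.

Lemma continuous_compose (U V : topologicalType) (f : T -> U) (g : U -> V) :
  continuous g -> continuous f -> continuous (fun x => g (f x)).
Proof. by move=> cg cf x; apply: continuous_comp; [exact: cf|exact: cg]. Qed.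

Lemma continuous_add f g :
  continuous f -> continuous g -> continuous (fun x => f x + g x).
Proof. by move=> cf cg x; apply: continuousD; [exact: cf|exact: cg]. Qed.

Lemma continuous_opp f : continuous f -> continuous (fun x => - f x).
Proof. by move=> cf x; apply: continuousN; exact: cf. Qed.

Lemma continuous_mul f g :
  continuous f -> continuous g -> continuous (fun x => f x * g x).
Proof. by move=> cf cg x; apply: continuousM; [exact: cf|exact: cg]. Qed.

Lemma continuous_minr f g :
  continuous f -> continuous g -> continuous (fun x => Num.min (f x) (g x)).
Proof. by move=> cf cg x; apply: continuous_min; [exact: cf|exact: cg]. Qed.

Lemma continuous_maxr f g :
  continuous f -> continuous g -> continuous (fun x => Num.max (f x) (g x)).
Proof. by move=> cf cg x; apply: continuous_max; [exact: cf|exact: cg]. Qed.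

Lemma continuous_const (c : R) : continuous (fun _ : T => c).
Proof. by move=> x; exact: cvg_cst. Qed.

End ContinuousMaps.

Lemma continuous_proj1 (U V : topologicalType) : continuous (@fst U V).
Proof. by move=> x; exact: cvg_fst. Qed.

Lemma continuous_proj2 (U V : topologicalType) : continuous (@snd U V).
Proof. by move=> x; exact: cvg_snd. Qed.

Lemma continuous_fst_of (T U V : topologicalType) (f : T -> U * V) :
  continuous f -> continuous (fun x => (f x).1).
Proof. exact: continuous_compose (@continuous_proj1 U V). Qed.

Lemma continuous_snd_of (T U V : topologicalType) (f : T -> U * V) :
  continuous f -> continuous (fun x => (f x).2).
Proof. exact: continuous_compose (@continuous_proj2 U V). Qed.

Lemma continuous_idfun (T : topologicalType) : continuous (fun x : T => x).
Proof. by move=> x. Qed.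

Ltac cont :=
  let body f :=
    lazymatch f with
    | (fun x => (@?g x, @?h x)) => apply: (@continuous_pair _ _ _ g h); cont
    | (fun x => @?g x + @?h x) => apply: (@continuous_add _ _ g h); cont
    | (fun x => - (@?g x)) => apply: (@continuous_opp _ _ g); cont
    | (fun x => @?g x * @?h x) => apply: (@continuous_mul _ _ g h); cont
    | (fun x => (@?g x) ^+ 2) => apply: (@continuous_mul _ _ g g); cont
    | (fun x => Num.min (@?g x) (@?h x)) => apply: (@continuous_minr _ _ g h); cont
    | (fun x => Num.max (@?g x) (@?h x)) => apply: (@continuous_maxr _ _ g h); cont
    | (fun x => x.1) => exact: continuous_proj1
    | (fun x => x.2) => exact: continuous_proj2
    | (fun x => (@?g x).1) => apply: (@continuous_fst_of _ _ _ g); cont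
    | (fun x => (@?g x).2) => apply: (@continuous_snd_of _ _ _ g); cont
    | (fun x => cos (@?g x)) =>
        apply: (@continuous_compose _ _ _ g _ (@continuous_cos _)); cont
    | (fun x => sin (@?g x)) =>
        apply: (@continuous_compose _ _ _ g _ (@continuous_sin _)); cont
    | (fun x => Num.sqrt (@?g x)) =>
        apply: (@continuous_compose _ _ _ g _ (@sqrt_continuous _)); cont
    | (fun x => x) => exact: continuous_idfun
    | (fun x => ?c) => exact: continuous_const
    | _ => idtac
    end in
  cbv beta;
  first [ assumption
        | let y := fresh in intro y;
          lazymatch goal with |- @continuous_at _ _ _ ?f => revert y; body f end ].

Section Circle.
Variable R : realType.
Implicit Types (z w : R * R) (t x y : R).

Definition cis t : R * R := (cos (2 * pi * t), sin (2 * pi * t)).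
Definition cmul z w : R * R := (z.1 * w.1 - z.2 * w.2, z.1 * w.2 + z.2 * w.1).
Definition conjp z : R * R := (z.1, - z.2).
Definition scalep (r : R) z : R * R := (r * z.1, r * z.2).
Definition cabs z : R := Num.sqrt (z.1 ^+ 2 + z.2 ^+ 2).
Definition cpow z n : R * R := iter n (cmul z) (1, 0).

Lemma cmulC z w : cmul z w = cmul w z.
Proof. by rewrite /cmul; congr pair; ring. Qed.

Lemma cmulA z w v : cmul z (cmul w v) = cmul (cmul z w) v.
Proof. by rewrite /cmul /=; congr pair; ring. Qed.

Lemma cmul1 z : cmul (1, 0) z = z.
Proof. by case: z => a b; rewrite /cmul /=; congr pair; ring. Qed.

Lemma cmulACA z w v u :
  cmul (cmul z w) (cmul v u) = cmul (cmul z v) (cmul w u).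
Proof. by rewrite /cmul /=; congr pair; ring. Qed.

Lemma cmul_conjp z w : conjp (cmul z w) = cmul (conjp z) (conjp w).
Proof. by rewrite /conjp /cmul /=; congr pair; ring. Qed.

Lemma cpow_cmul z w n : cpow (cmul z w) n = cmul (cpow z n) (cpow w n).
Proof.
elim: n => [|n IH]; first by rewrite cmul1.
by rewrite /cpow !iterS -!/(cpow _ _) IH cmulACA.
Qed.

Lemma cmul_scale r z x w :
  cmul (scalep r z) (scalep x w) = scalep (r * x) (cmul z w).
Proof. by rewrite /scalep /cmul /=; congr pair; ring. Qed.

Lemma cmul_scalel r z w : cmul (scalep r z) w = scalep r (cmul z w).
Proof. by rewrite /scalep /cmul /=; congr pair; ring. Qed.

Lemma cpow_scale r z n : cpow (scalep r z) n = scalep (r ^+ n) (cpow z n).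
Proof.
elim: n => [|n IH]; first by rewrite /scalep /cpow /= expr0; congr pair; ring.
by rewrite /cpow !iterS -!/(cpow _ _) IH cmul_scale exprS.
Qed.

Lemma conjp_scale r z : conjp (scalep r z) = scalep r (conjp z).
Proof. by rewrite /conjp /scalep /= mulrN. Qed.

Lemma cis0 : cis 0 = (1, 0).
Proof. by rewrite /cis mulr0 cos0 sin0. Qed.

Lemma cisD x y : cis (x + y) = cmul (cis x) (cis y).
Proof. by rewrite /cis /cmul mulrDr cosD sinD /=; congr pair; ring. Qed.

Lemma conjp_cis x : conjp (cis x) = cis (- x).
Proof. by rewrite /cis /conjp mulrN cosN sinN. Qed.

Lemma cpow_cis x n : cpow (cis x) n = cis (n%:R * x).
Proof.
elim: n => [|n IH]; first by rewrite mul0r cis0.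
by rewrite /cpow iterS -/(cpow _ _) IH -cisD -natr1 mulrDl mul1r addrC.
Qed.

Lemma cis1 : cis 1 = (1, 0).
Proof. by rewrite /cis mulr1 mulr_natl cos2pi sin2pi. Qed.

Lemma cis_nat n : cis n%:R = (1, 0).
Proof.
elim: n => [|n IH]; first exact: cis0.
by rewrite -natr1 cisD IH cis1 cmul1.
Qed.

Lemma cis_int (k : int) : cis k%:~R = (1, 0).
Proof.
case: k => n; first exact: cis_nat.
by rewrite NegzE mulrNz -conjp_cis cis_nat /conjp oppr0.
Qed.

(** Modulo its floor, [x] becomes [y] in [0, 1). If [y <= 1/2] the angle lies in [0, pi], where cos
    is injective; otherwise [1 - y] has the same cosine and is small. *)
Lemma cis_eq1 x : cis x = (1, 0) -> exists k : int, x = k%:~R.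
Proof.
move=> [cx _]; exists (Num.floor x).
have /andP[fx xf] := floor_itv x.
set y := x - (Num.floor x)%:~R.
have y0 : 0 <= y by rewrite subr_ge0.
have y1 : y < 1 by rewrite ltrBlDl; move: xf; rewrite intrD.
have cy : cos (2 * pi * y) = 1.
  suff : cis y = (1, 0) by case.
  rewrite /y cisD -mulrNz cis_int cmulC cmul1.
  rewrite /cis cx; congr pair; apply: cos1sin0.
  by rewrite cx normr1.
have p0 := pi_gt0 R.
have pos_small v : 0 <= v -> v <= 2^-1 -> cos (2 * pi * v) = 1 -> v = 0 :> R.
  move=> v0 vh cv.
  have : 2 * pi * v = 0.
    apply: (@cos_inj R); last by rewrite cos0.
      rewrite in_itv /=; apply/andP; split; first by rewrite !mulr_ge0// ltW.
      nra.
    by rewrite in_itv /= lexx ltW.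
  by move/eqP; rewrite !mulf_eq0 (gt_eqF p0) pnatr_eq0 /= => /eqP.
suff : y = 0 by move/eqP; rewrite subr_eq0 => /eqP.
have [yh|yh] := leP y 2^-1; first exact: pos_small.
have : 1 - y = 0.
  apply: pos_small; [lra|lra|].
  by rewrite mulrBr mulr1 cosB cy mulr_natl cos2pi sin2pi mulr1 mul0r addr0.
by move=> ?; lra.
Qed.

Lemma cis_eq x y : cis x = cis y -> exists k : int, x = y + k%:~R.
Proof.
move=> e; have [k kE] : exists k : int, x - y = k%:~R.
  apply: cis_eq1; rewrite cisD -conjp_cis e conjp_cis -cisD addrN.
  exact: cis0.
by exists k; rewrite -kE addrC subrK.
Qed.

Lemma cabs_scale_cis r t : 0 <= r -> cabs (scalep r (cis t)) = r.
Proof.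
move=> r0; rewrite /cabs /scalep /cis /= !exprMn -mulrDr cos2Dsin2 mulr1.
by rewrite sqrtr_sqr ger0_norm.
Qed.

Lemma cabs_ge0 z : 0 <= cabs z. Proof. exact: sqrtr_ge0. Qed.

(** Away from the origin the angle is [acos (x / r)], negated in the lower half-plane; at the origin
    any angle serves. *)
Lemma polar z : exists t, z = scalep (cabs z) (cis t).
Proof.
case: z => x y.
have [z0|z0] := eqVneq (x ^+ 2 + y ^+ 2) 0.
  have /andP[/eqP x0 /eqP y0] : (x ^+ 2 == 0) && (y ^+ 2 == 0).
    by rewrite -paddr_eq0 ?sqr_ge0// z0.
  exists 0; rewrite /cabs /= z0 sqrtr0 /scalep !mul0r.
  by move/eqP: x0; move/eqP: y0; rewrite !sqrf_eq0 => /eqP-> /eqP->.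
have pi0 : (pi : R) != 0 by rewrite gt_eqF// pi_gt0.
set r := cabs (x, y).
have r2 : r ^+ 2 = x ^+ 2 + y ^+ 2 by rewrite sqr_sqrtr// addr_ge0 ?sqr_ge0.
have r0 : 0 < r by rewrite sqrtr_gt0 lt_neqAle eq_sym z0 addr_ge0 ?sqr_ge0.
have xr : -1 <= x / r <= 1.
  rewrite ler_pdivlMr// ler_pdivrMr//.
  have : `|x| <= `|r|.
    by rewrite -(@ler_pXn2r _ 2)// ?nnegrE// !real_normK ?num_real// r2 lerDl sqr_ge0.
  by rewrite (gtr0_norm r0) ler_norml mulN1r mul1r.
have sE : 1 - (x / r) ^+ 2 = (y / r) ^+ 2.
  by rewrite !expr_div_n -(@divff _ (r ^+ 2)) ?gt_eqF ?exprn_gt0// -mulrBl {1}r2 addrAC subrr add0r.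
have rr a : a = r * (a / r) by rewrite mulrCA mulfV ?mulr1// gt_eqF.
have [y0|y0] := leP 0 y.
  exists (acos (x / r) / (2 * pi)).
  rewrite /scalep /cis mulrCA mulfV ?mulr1 ?mulf_neq0//= acosK ?in_itv//=.
  by rewrite sin_acos// sE sqrtr_sqr ger0_norm ?divr_ge0 ?(ltW r0)// -!rr.
exists (- (acos (x / r) / (2 * pi))).
rewrite /scalep /cis mulrN mulrCA mulfV ?mulr1 ?mulf_neq0//= cosN sinN acosK ?in_itv//=.
rewrite sin_acos// sE sqrtr_sqr normf_div (gtr0_norm r0) ltr0_norm//.
by rewrite mulNr opprK -!rr.
Qed.

Lemma continuous_cmul (T : topologicalType) (f g : T -> R * R) :
  continuous f -> continuous g -> continuous (fun p => cmul (f p) (g p)).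
Proof. by move=> cf cg; rewrite /cmul; cont. Qed.

Lemma continuous_cis (T : topologicalType) (f : T -> R) :
  continuous f -> continuous (fun p => cis (f p)).
Proof. by move=> cf; rewrite /cis; cont. Qed.

Lemma continuous_conjp (T : topologicalType) (f : T -> R * R) :
  continuous f -> continuous (fun p => conjp (f p)).
Proof. by move=> cf; rewrite /conjp; cont. Qed.

Lemma continuous_cpow (T : topologicalType) (f : T -> R * R) n :
  continuous f -> continuous (fun p => cpow (f p) n).
Proof.
move=> cf; elim: n => [|n IH]; first by move=> p; exact: cvg_cst.
exact: (continuous_cmul cf IH).
Qed.

Lemma continuous_cabs : continuous cabs.
Proof. by rewrite /cabs; cont. Qed.

End Circle.

(** * Periodic functions on the circle extended to the plane *)


Section Periodic.
Variable R : realType.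
Implicit Types (f : R -> R) (x : R).

Lemma periodic_int f : (forall x, f (x + 1) = f x) ->
  forall (k : int) x, f (x + k%:~R) = f x.
Proof.
move=> fp; have fn n x : f (x + n%:R) = f x.
  elim: n => [|n IH]; first by rewrite addr0.
  by rewrite -natr1 addrA fp.
case=> n x; first exact: fn.
by rewrite NegzE mulrNz -(fn n.+1) -addrA addNr addr0.
Qed.

Lemma periodic_bounded f : continuous f -> (forall x, f (x + 1) = f x) ->
  exists2 M, 0 < M & forall x, `|f x| <= M.
Proof.
move=> cf fp.
have [c _ cM] := @EVT_max R (fun x => `|f x|) 0 1 ler01
  (continuous_subspaceT (continuous_compose (@norm_continuous _ _) cf)).
(* The added 1 keeps the bound positive even when [f] vanishes, so that one may divide by it. *)
exists (`|f c| + 1) => [|x]; first by rewrite ltr_pwDr// normr_ge0.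
have /andP[fx xf] := floor_itv x.
rewrite -(subrK (Num.floor x)%:~R x) (periodic_int fp).
apply: (le_trans (cM _ _)); last by rewrite lerDl ler01.
rewrite in_itv /= subr_ge0 fx /= lerBlDl.
by move: xf; rewrite intrD => /ltW.
Qed.

Lemma cis_atan x : scalep (Num.sqrt (1 + x ^+ 2)) (cis (atan x / (2 * pi))) = (1, x).
Proof.
have p0 : (2 * pi : R) != 0 by rewrite mulf_neq0// gt_eqF// pi_gt0.
have s0 : Num.sqrt (1 + x ^+ 2) != 0.
  by rewrite gt_eqF// sqrtr_gt0 ltr_pwDl// sqr_ge0.
have ca : cos (atan x) != 0 by rewrite cos_atan invr_eq0.
rewrite /scalep /cis mulrCA mulfV// mulr1 /= cos_atan mulfV//.
by congr pair; rewrite -[RHS]atanK /tan cos_atan invrK mulrC.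
Qed.

(* Near a point [r0 e(t0)] with [r0 > 0] the angle is [t0 + atan (Y / X) / (2 pi)],
   [(X, Y)] being the quotient by [e(t0)]; at the origin [f] is bounded. *)
Lemma circle_extension f : continuous f -> (forall x, f (x + 1) = f x) ->
  exists F : R * R -> R, continuous F /\
    forall r t, 0 <= r -> F (scalep r (cis t)) = r * f t.
Proof.
move=> cf fp; have [arg argE] := choice (@polar R).
(* [arg] is an arbitrary choice of angle, with no continuity; [F] does not depend on it because two
   angles of a nonzero point differ by an integer and [f] is 1-periodic. *)
pose F z := cabs z * f (arg z).
have FE r t : 0 <= r -> F (scalep r (cis t)) = r * f t.
  move=> r0; rewrite /F cabs_scale_cis//.
  have [->|rn0] := eqVneq r 0; first by rewrite !mul0r.
  congr (_ * _); have := argE (scalep r (cis t)).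
  rewrite cabs_scale_cis// => -[/(mulfI rn0) e1 /(mulfI rn0) e2].
  have [k kE] : exists k : int, t = arg (scalep r (cis t)) + k%:~R.
    by apply: cis_eq; congr pair.
  by rewrite [in RHS]kE (periodic_int fp).
exists F; split=> // z0.
have [t0 z0E] := polar z0; have := cabs_ge0 z0.
rewrite le_eqVlt => /orP[/eqP r0|r0].
  have [M M0 fM] := periodic_bounded cf fp.
  have F0 : F z0 = 0 by rewrite /F -r0 mul0r.
  apply/cvgrPdist_lt => e e0; rewrite F0.
  have : cabs z @[z --> z0] --> cabs z0 by exact: continuous_cabs.
  move/cvgrPdist_lt => /(_ (e / M) (divr_gt0 e0 M0)); apply: filterS => z.
  rewrite -r0 !sub0r !normrN => zM; rewrite /F normrM.
  apply: le_lt_trans (ler_wpM2l _ (fM _)) _ => //.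
  by rewrite -ltr_pdivlMr.
pose q z := cmul z (cis (- t0)).
pose G z := cabs z * f (t0 + atan ((q z).2 / (q z).1) / (2 * pi)).
have qE z : z = cmul (q z) (cis t0).
  by rewrite /q -cmulA -cisD addNr cis0 cmulC cmul1.
have qz0 : q z0 = (cabs z0, 0).
  rewrite /q {1}z0E.
  rewrite cmul_scalel -cisD addrN cis0.
  by rewrite /scalep /= !mulr1 mulr0.
have FG z : 0 < (q z).1 -> F z = G z.
  move=> X0; set X := (q z).1 in X0 *; set Y := (q z).2.
  pose c := X * Num.sqrt (1 + (Y / X) ^+ 2).
  have c0 : 0 <= c by rewrite mulr_ge0 ?sqrtr_ge0 ?ltW.
  have zE : z = scalep c (cis (t0 + atan (Y / X) / (2 * pi))).
    rewrite {1}[z]qE cisD.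
    have -> : q z = scalep c (cis (atan (Y / X) / (2 * pi))).
      have := cis_atan (Y / X); rewrite /scalep => -[e1 e2].
      rewrite /c -!mulrA e1 e2 mulr1 mulrCA mulfV ?gt_eqF// mulr1.
      by rewrite /X /Y; case: (q z).
    by rewrite cmul_scalel cmulC.
  by rewrite {1}zE FE// /G {1}zE cabs_scale_cis.
have cq : continuous q 
  by apply: continuous_cmul; [exact: continuous_idfun|move=> ?; exact: cvg_cst].
have cq1 : continuous (fun z => (q z).1) by exact: continuous_fst_of.
have cq2 : continuous (fun z => (q z).2) by exact: continuous_snd_of.
have qgt0 : \forall z \near z0, 0 < (q z).1.
  have := cq1 z0; rewrite /continuous_at qz0 => /cvgr_gt; exact.
have cG : {for z0, continuous G}.
  apply: (@continuousM _ _ (@cabs R) (fun z => f _)); first exact: continuous_cabs.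
  apply: (@continuous_comp _ _ _ (fun z => t0 + _) f); last exact: cf.
  apply: (@continuousD _ _ _ (fun=> t0) (fun z => _ / _)); first exact: cvg_cst.
  apply: (@continuousM _ _ (fun z => atan _) (fun=> (2 * pi)^-1)); last exact: cvg_cst.
  apply: (@continuous_comp _ _ _ (fun z => (q z).2 / (q z).1) (@atan R));
    last exact: continuous_atan.
  apply: (@continuousM _ _ (fun z => (q z).2) (fun z => _^-1)); first exact: cq2.
  by apply: (@continuousV _ _ (fun z => (q z).1)); [rewrite qz0 gt_eqF|exact: cq1].
apply: (@cvg_trans _ (G z @[z --> z0])); last by rewrite FG ?qz0.
by apply: near_eq_cvg; apply: filterS qgt0 => z /FG.
Qed.

End Periodic.

(** * Shears of the torus as isotopies of the sphere *)


Section Isotopy.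
Variable R : realType.

(* Unlike in [ambient_isotopic], the isotopy is continuous on all of [R x R^4],
   which makes stagewise composition immediate. *)
Definition global_isotopic (K L : set (R4 R)) : Prop :=
  exists H : R -> R4 R -> R4 R,
    [/\ continuous (fun z : R * R4 R => H z.1 z.2),
        forall t, set_bij (S3 R) (S3 R) (H t),
        forall x, H 0 x = x &
        H 1 @` K = L].

Lemma global_isotopic_trans K L M :
  global_isotopic K L -> global_isotopic L M -> global_isotopic K M.
Proof.
move=> [H [cH bH H0 <-]] [G [cG bG G0 <-]].
exists (fun t x => G t (H t x)); split.
- apply: (@continuous_compose _ _ _ (fun z : R * R4 R => (z.1, H z.1 z.2)) _ cG).
  by apply: continuous_pair => //; exact: continuous_proj1.
- by move=> t; apply: set_bij_comp (bH t) (bG t).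
- by move=> x; rewrite G0 H0.
- by rewrite -image_comp.
Qed.

Lemma global_isotopic_ambient K L :
  K `<=` S3 R -> global_isotopic K L -> ambient_isotopic K L.
Proof.
move=> KS [H [cH bH H0 HK]]; exists H; split=> //.
by apply: continuous_subspaceT.
Qed.

Lemma ambient_isotopic_refl (K : set (R4 R)) : K `<=` S3 R -> ambient_isotopic K K.
Proof.
move=> KS; apply: global_isotopic_ambient => //.
exists (fun _ x => x); split=> //; first exact: continuous_proj2.
- by move=> _; split=> // y Sy; exists y.
- by rewrite image_id.
Qed.

Lemma torusE (v : R * R) :
  torus v = (scalep (Num.sqrt 2)^-1 (cis v.1), scalep (Num.sqrt 2)^-1 (cis v.2)).
Proof. by rewrite /torus /scalep /cis /= !(mulrC (_^-1)). Qed.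

Lemma S3_torus (v : R * R) : S3 R (torus v).
Proof.
rewrite /S3 /torus /= !expr_div_n sqr_sqrtr ?ler0n//.
by rewrite -addrA -!mulrDl !cos2Dsin2; field.
Qed.

Lemma torus_eq (v w : R * R) : torus v = torus w ->
  exists i j : int, v.1 = w.1 + i%:~R /\ v.2 = w.2 + j%:~R.
Proof.
have s0 : (Num.sqrt 2 : R)^-1 != 0 by rewrite invr_eq0 gt_eqF// sqrtr_gt0 ltr0n.
rewrite !torusE /scalep => -[/(mulfI s0) e1 /(mulfI s0) e2 /(mulfI s0) e3 /(mulfI s0) e4].
have [i iE] : exists i : int, v.1 = w.1 + i%:~R by apply: cis_eq; congr pair.
have [j jE] : exists j : int, v.2 = w.2 + j%:~R by apply: cis_eq; congr pair.
by exists i, j.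
Qed.

Lemma torusD_int (x y : R) (i j : int) : torus (x + i%:~R, y + j%:~R) = torus (x, y).
Proof. by rewrite !torusE /= !cisD !cis_int !(cmulC _ (1, 0)) !cmul1. Qed.

(* The circle acts on S^3 by [e(t) (z, w) = (e(a t) z, e(b t) w)], and
   [w^a conj(z)^b] is invariant; moving every point along its orbit by a function
   of this invariant is thus a homeomorphism. On the torus the invariant has
   argument [a y - b x]. *)
Lemma torus_shear (a b : nat) (k : R -> R) (C : set (R * R)) :
  continuous k -> (forall x, k (x + 1) = k x) ->
  global_isotopic (@torus R @` C)
    (@torus R @` [set (v.1 + a%:R * k (a%:R * v.2 - b%:R * v.1),
                    v.2 + b%:R * k (a%:R * v.2 - b%:R * v.1)) | v in C]).
Proof.
move=> ck kp; set r : R := (Num.sqrt 2)^-1.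
have r0 : 0 < r by rewrite invr_gt0 sqrtr_gt0 ltr0n.
pose c := r ^+ a * r ^+ b.
have c0 : 0 < c by rewrite mulr_gt0 ?exprn_gt0.
(* On the torus the invariant has modulus [c], and [F] is multiplied by that modulus; the factor
   [c^-1] cancels it. *)
have [F [cF FE]] := @circle_extension R (fun x => c^-1 * k x)
  (continuous_mul (@continuous_const _ _ _) ck)
  (fun x => congr1 ( *%R c^-1) (kp x)).
pose inv (x : R4 R) := cmul (cpow x.2 a) (conjp (cpow x.1 b)).
pose act (t : R) (x : R4 R) : R4 R :=
  (cmul (cis (a%:R * t)) x.1, cmul (cis (b%:R * t)) x.2).
have inv_act t x : inv (act t x) = inv x.
  rewrite /inv /act /= !cpow_cmul !cpow_cis cmul_conjp cmulACA conjp_cis -cisD.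
  by rewrite mulrCA subrr cis0 cmul1.
have actD s t x : act s (act t x) = act (s + t) x.
  by rewrite /act /= !cmulA -!cisD !mulrDr.
have act0 x : act 0 x = x.
  by rewrite /act !mulr0 cis0 !cmul1; case: x.
have act_S3 t x : S3 R x -> S3 R (act t x).
  rewrite /S3 /act /cmul /cis /= => Sx.
  have := cos2Dsin2 (2 * pi * (a%:R * t)); have := cos2Dsin2 (2 * pi * (b%:R * t)).
  set c1 := cos _; set s1 := sin _; set c2 := cos _; set s2 := sin _ => h1 h2.
  transitivity ((c2 ^+ 2 + s2 ^+ 2) * (x.1.1 ^+ 2 + x.1.2 ^+ 2) +
                (c1 ^+ 2 + s1 ^+ 2) * (x.2.1 ^+ 2 + x.2.2 ^+ 2)); first by ring.
  by rewrite h1 h2 !mul1r addrA.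
exists (fun t x => act (t * F (inv x)) x); split.
- have cinv : continuous (fun z : R * R4 R => inv z.2).
    apply: continuous_cmul; first by apply: continuous_cpow; cont.
    by apply: continuous_conjp; apply: continuous_cpow; cont.
  have cFi := continuous_compose cF cinv.
  have ct : continuous (fun z : R * R4 R => z.1 * F (inv z.2)) by cont.
  apply: continuous_pair; apply: continuous_cmul; try (by cont);
    apply: continuous_cis.
  + exact: continuous_mul (@continuous_const _ _ _) ct.
  + exact: continuous_mul (@continuous_const _ _ _) ct.
- move=> t; split.
  + by move=> x; exact: act_S3.
  (* Points with the same image have the same invariant, hence were moved by the same group element,
     which can be undone. *)
  + move=> x y _ _ /= e; have := congr1 inv e; rewrite !inv_act => ei.
    move: e; rewrite ei => /(congr1 (act (- (t * F (inv y))))).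
    by rewrite !actD !addNr !act0.
  + move=> y Sy; exists (act (- (t * F (inv y))) y); first exact: act_S3.
    by rewrite inv_act actD addrN act0.
- by move=> x; rewrite mul0r act0.
- rewrite !image_comp; apply: eq_imagel => -[x y] _ /=.
  have -> : inv (torus (x, y)) = scalep c (cis (a%:R * y - b%:R * x)).
    rewrite /inv torusE /= !cpow_scale conjp_scale cmul_scale !cpow_cis conjp_cis.
    by rewrite -cisD -/r [in X in scalep X]mulrC.
  rewrite FE ?ltW// mul1r mulrA mulfV ?gt_eqF// mul1r.
  rewrite /act !torusE /= !(cmulC (cis _)) !cmul_scalel -!cisD.
  by [].
Qed.

End Isotopy.

(** * Periodic extensions and inverse functions *)


Section Periodize.
Variable R : realType.
Implicit Types (a b f g : R -> R) (x y t : R).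

(* Around [x], with [n] the floor of [x], the extension is the continuous
   function [g (t - n) + g (t - n + 1)]. *)
Lemma periodic_extension g : continuous g ->
  (forall x, x <= 0 -> g x = 0) -> (forall x, 1 <= x -> g x = 0) ->
  exists f, [/\ continuous f, forall x, f (x + 1) = f x &
    forall x, 0 <= x <= 1 -> f x = g x].
Proof.
move=> cg g0 g1; pose f x := g (x - (Num.floor x)%:~R); exists f.
have fE (n : int) t : n%:~R - 1 < t -> t < n%:~R + 1 ->
    f t = g (t - n%:~R) + g (t - n%:~R + 1).
  move=> nt tn; have [tln|nlt] := ltP t n%:~R.
    rewrite /f (@floor_def _ _ (n - 1)); last first.
      by rewrite subrK tln rmorphB /= ltW.
    by rewrite [g (t - n%:~R)]g0 ?add0r ?subr_le0 ?ltW// rmorphB /= opprB addrA addrAC.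
  rewrite /f (@floor_def _ _ n) ?nlt ?rmorphD//.
  by rewrite [g (_ + 1)]g1 ?addr0// lerDr subr_ge0.
split=> [x|x|x /andP[x0 x1]].
- set n := Num.floor x.
  have /andP[nx xn] := floor_itv x; rewrite -/n rmorphD /= in nx xn.
  have nx1 : n%:~R - 1 < x by rewrite ltrBlDr (le_lt_trans nx)// ltrDl.
  pose G t := g (t - n%:~R) + g (t - n%:~R + 1).
  have cG : continuous G.
    rewrite /G; apply: continuous_add; apply: (continuous_compose cg); cont.
  apply: (@cvg_trans _ (G t @[t --> x])); last by rewrite (fE n)//; exact: cG.
  apply: near_eq_cvg; near=> t; rewrite (fE n)//; near: t.
    exact: lt_nbhsr.
  exact: lt_nbhsl.
- by rewrite /f floorDrz ?rmorphD /= ?floor1// opprD addrACA subrr addr0.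
(* At 1 the floor jumps, so [f 1] is [g 0]; this agrees with [g 1], both being 0. *)
- have [->|x1n] := eqVneq x 1.
    by rewrite /f floor1 subrr g0// g1.
  by rewrite /f (@floor_def _ _ 0) ?subr0// x0 add0r lt_neqAle x1n.
Unshelve. all: by end_near. Qed.

(** The inverse is increasing too, so the open interval from [b (g y - e)] to [b (g y + e)] is a
    neighbourhood of [y] that it maps within [e] of [g y]. *)
Lemma increasing_inverse b : {mono b : x y / x < y} ->
  (forall y, exists x, b x = y) ->
  exists g, continuous g /\ forall x, g (b x) = x.
Proof.
move=> bm bs; have [g gE] := choice bs; exists g.
have binj x y : b x = b y -> x = y.
  move=> e; have := bm x y; have := bm y x; rewrite e !ltxx.
  by case: (ltgtP x y).
have gb x : g (b x) = x by apply: binj; rewrite gE.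
have gm x y : (g x < g y) = (x < y) by rewrite -[LHS]bm !gE.
split=> // y; apply/cvgrPdist_lt => e e0.
have y1 : b (g y - e) < y by rewrite -gm gb ltrBlDr ltrDl.
have y2 : y < b (g y + e) by rewrite -gm gb ltrDl.
near=> z; rewrite ltr_distlC -[X in X < _]gb -[X in _ && (_ < X)]gb !gm.
apply/andP; split; near: z; [exact: lt_nbhsr|exact: lt_nbhsl].
Unshelve. all: by end_near. Qed.

End Periodize.

(** * Straightening the zigzag *)


Section Straighten.
Variable R : realType.
Implicit Types (a b f g : R -> R) (x y t : R).

Definition clamp (T x : R) : R := Num.min T (Num.max 0 x).

Variant clamp_spec (T x : R) : R -> Prop :=
| ClampLow of x <= 0 : clamp_spec T x 0
| ClampMid of 0 <= x & x <= T : clamp_spec T x x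
| ClampHigh of T <= x : clamp_spec T x T.

Lemma clampP T x : 0 <= T -> clamp_spec T x (clamp T x).
Proof.
move=> T0; rewrite /clamp /Num.min /Num.max.
case: (ltP 0 x) => [x0|x0].
  case: (ltP T x) => [Tx|xT]; first exact: ClampHigh (ltW Tx).
  exact: ClampMid (ltW x0) xT.
by case: (ltP T 0) => [|_]; [rewrite ltNge T0|exact: ClampLow].
Qed.

Lemma continuous_clamp (V : topologicalType) T (h : V -> R) :
  continuous h -> continuous (fun p => clamp T (h p)).
Proof. by move=> ch; rewrite /clamp; cont. Qed.

Lemma clamp_le T x y : 0 <= T -> x <= y -> clamp T x <= clamp T y.
Proof. by move=> T0 xy; do 2 case: clampP => //; lra. Qed.

Lemma clamp_id T x : 0 <= x <= T -> clamp T x = x.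
Proof. by move=> xT; case: clampP; lra. Qed.

Lemma clamp_low T x : 0 <= T -> x <= 0 -> clamp T x = 0.
Proof. by move=> T0 x0; case: clampP => //; lra. Qed.

Lemma clamp_high T x : 0 <= T -> T <= x -> clamp T x = T.
Proof. by move=> T0 x0; case: clampP => //; lra. Qed.

(** As [b] increases, the curve (a, b) is the graph of a function of [b] on [0, 1]. Its deviation
    from the line a = 2 b vanishes at both ends, hence extends periodically to a function [h] whose
    shear carries the curve onto that line. *)
Lemma graph_function a b T : 0 < T -> continuous a -> continuous b ->
    (forall x y, 0 <= x -> x < y -> y <= T -> b x < b y) ->
    b 0 = 0 -> b T = 1 -> a 0 = 0 -> a T = 2 ->
  (forall y, 0 <= y <= 1 -> exists2 t, 0 <= t <= T & b t = y) /\
  exists h, [/\ continuous h, forall x, h (x + 1) = h x &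
    forall t, 0 <= t <= T -> h (b t) = 2 * b t - a t].
Proof.
move=> T0 ca cb bm b0 bT a0 aT.
(* Continuing [b] with slope 1 on both sides of [0, T] yields an increasing bijection of the whole
   line. *)
pose b' x := b (clamp T x) + (x - clamp T x).
have ccl : continuous (clamp T) by apply: continuous_clamp; exact: continuous_idfun.
have cb' : continuous b'.
  by apply: continuous_add; [exact: continuous_compose|cont].
have clT x : 0 <= clamp T x <= T by case: clampP; lra.
have bm' x y : x < y -> b' x < b' y.
  move=> xy; have /andP[x0 _] := clT x; have /andP[_ yT] := clT y.
  have lip : x - clamp T x <= y - clamp T y by do 2 (case: clampP; first lra); lra.
  have := @clamp_le T x y (ltW T0) (ltW xy).
  rewrite le_eqVlt => /predU1P[e|xy']; first by rewrite /b' e; lra.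
  by have := bm _ _ x0 xy' yT; rewrite /b'; lra.
have bmono : {mono b' : x y / x < y}.
  move=> x y; apply/idP/idP => [|/bm'//]; apply: contraTT.
  by rewrite -!leNgt le_eqVlt => /predU1P[->//|/bm' /ltW].
have b'E x : 0 <= x <= T -> b' x = b x by move=> xT; rewrite /b' clamp_id// subrr addr0.
have b'0 : b' 0 = 0 by rewrite b'E ?lexx ?ltW.
have b'T : b' T = 1 by rewrite b'E ?lexx ?ltW.
have bsurj y : exists x, b' x = y.
  have y0 := normr_ge0 y; have yn := ler_norm y; have := ler_norm (- y); rewrite normrN => ny.
  have bl : b' (- `|y|) = - `|y|.
    by rewrite /b' clamp_low ?b0; lra.
  have br : b' (T + `|y|) = 1 + `|y|.
    by rewrite /b' clamp_high ?bT; lra.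
  have [|||c _ cy] := @IVT R b' (- `|y|) (T + `|y|) y; last by exists c.
  - lra.
  - exact: continuous_subspaceT.
  - by rewrite bl br ge_min le_max; apply/andP; split; apply/orP; [left|right]; lra.
have [g [cg gb]] := increasing_inverse bmono bsurj.
split=> [y /andP[y0 y1]|].
  have [x xy] := bsurj y; have xT : 0 <= x <= T.
    by rewrite !leNgt -[x < 0]bmono -[T < x]bmono xy b'0 b'T -!leNgt y0.
  by exists x; rewrite // -b'E.
have g0 : g 0 = 0 by rewrite -{1}b'0.
have g1 : g 1 = T by rewrite -b'T.
have cc : continuous (clamp 1) by apply: continuous_clamp; exact: continuous_idfun.
have cG : continuous (fun y => 2 * clamp 1 y - a (g (clamp 1 y))).
  have c1 : continuous (fun y => a (g (clamp 1 y))).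
    exact: continuous_compose ca (continuous_compose cg cc).
  by cont.
have [||h [ch hp hE]] := periodic_extension cG.
- by move=> x x0; rewrite clamp_low// g0 a0; lra.
- by move=> x x0; rewrite clamp_high// g1 aT; lra.
exists h; split=> // t /andP[t0 tT].
have bt : 0 <= b t <= 1.
  have tt : 0 <= t <= T by rewrite t0.
  apply/andP; split; rewrite -b'E// leNgt.
    by rewrite -[ltRHS]b'0 bmono -leNgt.
  by rewrite -[ltLHS]b'T bmono -leNgt.
by rewrite hE// clamp_id// -b'E ?t0// gb.
Qed.

(** Each [clamp 1 (t - i)] is a ramp active on [i, i + 1], so the zigzag spends unit time on each
    piece. Pieces 0 and 2 are the edges of the band; pieces 1 and 3 are the arcs of the knot left by
    surgery, piece 1 being run backwards. *)
Definition zigzag_b t := clamp 1 t + clamp 1 (t - 2).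
Definition zigzag_s (s u : R) t :=
  s * clamp 1 t - (s - u) * clamp 1 (t - 1) + s * clamp 1 (t - 2)
  + (1 - s - u) * clamp 1 (t - 3).

Lemma continuous_zigzag_b : continuous zigzag_b.
Proof. by apply: continuous_add; apply: continuous_clamp; cont. Qed.

Lemma continuous_zigzag_s s u : continuous (zigzag_s s u).
Proof.
have cc c : continuous (fun t => clamp 1 (t - c)).
  by apply: continuous_clamp; cont.
have c0 : continuous (clamp 1) by apply: continuous_clamp; cont.
have [c1 c2 c3] := And3 (cc 1) (cc 2) (cc 3).
by rewrite /zigzag_s; cont.
Qed.

Lemma zigzag_piece0 s u t : 0 <= t <= 1 ->
  zigzag_b t = t /\ zigzag_s s u t = s * t.
Proof.
move=> t01; rewrite /zigzag_b /zigzag_s (clamp_id t01).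
by rewrite !(@clamp_low 1 (t - _)) ?ler01//; try lra; split; ring.
Qed.

Lemma zigzag_piece1 s u t : 0 <= t <= 1 ->
  zigzag_b (1 + t) = 1 /\ zigzag_s s u (1 + t) = s - (s - u) * t.
Proof.
move=> t01; rewrite /zigzag_b /zigzag_s (@clamp_high 1 (1 + t)) ?ler01//; last by lra.
rewrite (_ : 1 + t - 1 = t); last by ring.
rewrite (clamp_id t01) (@clamp_low 1 (1 + t - 2)) ?ler01//; last by lra.
rewrite (@clamp_low 1 (1 + t - 3)) ?ler01//; last by lra.
by split; ring.
Qed.

Lemma zigzag_piece2 s u t : 0 <= t <= 1 ->
  zigzag_b (2 + t) = 1 + t /\ zigzag_s s u (2 + t) = u + s * t.
Proof.
move=> t01; rewrite /zigzag_b /zigzag_s.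
rewrite (_ : 2 + t - 2 = t); last by ring.
rewrite (@clamp_high 1 (2 + t)) ?ler01//; last by lra.
rewrite (@clamp_high 1 (2 + t - 1)) ?ler01//; last by lra.
rewrite (clamp_id t01) (@clamp_low 1 (2 + t - 3)) ?ler01//; last by lra.
by split; ring.
Qed.

Lemma zigzag_piece3 s u t : 0 <= t <= 1 ->
  zigzag_b (3 + t) = 2 /\ zigzag_s s u (3 + t) = s + u + (1 - s - u) * t.
Proof.
move=> t01; rewrite /zigzag_b /zigzag_s.
rewrite (_ : 3 + t - 3 = t); last by ring.
rewrite (@clamp_high 1 (3 + t)) ?ler01//; last by lra.
rewrite (@clamp_high 1 (3 + t - 1)) ?ler01//; last by lra.
rewrite (@clamp_high 1 (3 + t - 2)) ?ler01//; last by lra.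
by rewrite (clamp_id t01); split; ring.
Qed.

Definition increasing_on b l r := forall x y, l <= x -> x < y -> y <= r -> b x < b y.

Lemma increasing_glue b l m r :
  increasing_on b l m -> increasing_on b m r -> increasing_on b l r.
Proof.
move=> i1 i2 x y lx xy yr; have [ym|my] := leP y m; first exact: i1.
have [mx|xm] := leP m x; first exact: i2.
by apply: (@lt_trans _ _ (b m)); [exact: i1|exact: i2].
Qed.

Lemma zigzag_straighten s u : 0 < u -> u < s -> s + u < 1 ->
  exists f k h,
    [/\ [/\ continuous f, continuous k & continuous h],
        [/\ forall x, f (x + 1) = f x, forall x, k (x + 1) = k x &
            forall x, h (x + 1) = h x],
        forall t, 0 <= t <= 4 ->
          zigzag_b t + f (zigzag_s s u t)
          + h (zigzag_s s u t + k (zigzag_b t + f (zigzag_s s u t)))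
          = 2 * (zigzag_s s u t + k (zigzag_b t + f (zigzag_s s u t))) &
        forall y, 0 <= y <= 1 -> exists2 t, 0 <= t <= 4 &
          zigzag_s s u t + k (zigzag_b t + f (zigzag_s s u t)) = y].
Proof.
move=> u0 us su1; have s0 : 0 < s by apply: lt_trans us.
have sn0 : s != 0 by rewrite gt_eqF.
pose w := u / s; have uE : u = w * s by rewrite /w mulfVK.
have w0 : 0 < w by rewrite divr_gt0.
have w1 : w < 1 by rewrite ltr_pdivrMr// mul1r.
(* [dl] and [kap] are the depths of the dips of [f] and [k]. After both shears, piece 1 increases
   iff [s - u < kap], and pieces 0 and 2 do if the slope [lam] is below [s], that is,
   [kap < s * (1 - dl)]. Since [dl < w] these bounds leave room, and [kap] is their midpoint. *)
pose dl := w * (1 - w); pose kap := s * (1 - w + w ^+ 2 / 2).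
have dl0 : 0 < dl by rewrite mulr_gt0// subr_gt0.
have dlw : dl <= 1 - w by rewrite /dl; nra.
have dl1 : 0 < 1 - dl by lra.
have kapl : s - u < kap by rewrite /kap uE; nra.
have kapr : kap < s * (1 - dl) by rewrite /kap /dl; nra.
pose lam := kap / (1 - dl); pose mu := kap / dl.
have lamE : lam * (1 - dl) = kap by rewrite /lam mulfVK ?gt_eqF.
have muE : mu * dl = kap by rewrite /mu mulfVK ?gt_eqF.
have lams : lam < s by rewrite /lam ltr_pdivrMr.
have kap0 : 0 < kap by lra.
have lam0 : 0 < lam by rewrite divr_gt0.
have mu0 : 0 < mu by rewrite divr_gt0.
have su0 : 0 < s - u by rewrite subr_gt0.
have d0 : 0 < 1 - s - u by lra.
(* Zero up to [u], down to [- dl] at [s], constant until [s + u], back to 0 at 1: on the two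
   vertical pieces this is linear, between the values 0 and [- dl]. *)
pose gf x := - (dl * (clamp 1 ((x - u) / (s - u)) - clamp 1 ((x - s - u) / (1 - s - u)))).
(* An inverted tent: slope [- lam] down to [- kap] at [1 - dl], then slope [mu] back to 0 at 1.
   Modulo 1, the tilt by [f] puts pieces 0 and 2 over [0, 1 - dl] and pieces 1 and 3 over
   [1 - dl, 1]. *)
pose gk y := - Num.max 0 (Num.min (lam * y) (mu * (1 - y))).
have cgf : continuous gf.
  have c1 : continuous (fun x => clamp 1 ((x - u) / (s - u))).
    by apply: continuous_clamp; cont.
  have c2 : continuous (fun x => clamp 1 ((x - s - u) / (1 - s - u))).
    by apply: continuous_clamp; cont.
  by rewrite /gf; cont.
have cgk : continuous gk by rewrite /gk; cont.
have [||f [cf fp fE]] := periodic_extension cgf.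
- move=> x x0; rewrite /gf !clamp_low ?ler01 ?pmulr_lle0 ?invr_gt0//; lra.
- move=> x x1; rewrite /gf !clamp_high ?ler01 ?ler_pdivlMr// ?mul1r; lra.
have [||k [ck kp kE]] := periodic_extension cgk.
- move=> x x0; rewrite /gk max_l ?oppr0// ge_min; apply/orP; left.
  by rewrite pmulr_rle0.
- move=> x x1; rewrite /gk max_l ?oppr0// ge_min; apply/orP; right.
  by rewrite pmulr_rle0// subr_le0.
have kfall y : 0 <= y <= 1 - dl -> k y = - (lam * y).
  move=> /andP[y0 y1]; rewrite kE /gk; last by rewrite y0; lra.
  have l1 : lam * y <= kap by rewrite -lamE ler_pM2l.
  have l2 : kap <= mu * (1 - y) by rewrite -muE ler_pM2l//; lra.
  by rewrite min_l ?(le_trans l1)// max_r// mulr_ge0// ltW.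
have krise y : 1 - dl <= y <= 1 -> k y = - (mu * (1 - y)).
  move=> /andP[y0 y1]; rewrite kE /gk; last by rewrite y1; lra.
  have l1 : kap <= lam * y by rewrite -lamE ler_pM2l.
  have l2 : mu * (1 - y) <= kap by rewrite -muE ler_pM2l//; lra.
  by rewrite min_r ?(le_trans l2)// max_r// mulr_ge0 ?subr_ge0// ltW.
(* The coordinates after the first two shears; from here on [b] is the one that started as s, and it
   is to be increasing. *)
pose a t := zigzag_b t + f (zigzag_s s u t); pose b t := zigzag_s s u t + k (a t).
have ffall x : 0 <= x <= s + u -> f x = - (dl * clamp 1 ((x - u) / (s - u))).
  move=> /andP[x0 x1]; rewrite fE ?x0; last by lra.
  rewrite /gf [X in _ - X]clamp_low ?subr0 ?ler01 ?pmulr_lle0 ?invr_gt0//; lra.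
have piece0 t (c := clamp 1 ((s * t - u) / (s - u))) : 0 <= t <= 1 ->
    a t = t - dl * c /\ b t = s * t - lam * (t - dl * c).
  move=> t01; have [zb zs] := zigzag_piece0 s u t01; rewrite /b.
  have -> : a t = t - dl * c.
    rewrite /a zb zs ffall//; move: t01 => /andP[t0 t1].
    by rewrite mulr_ge0 ?(ltW s0)//= ler_wpDr ?(ltW u0)// ger_pMr.
  split=> //; rewrite zs kfall//.
  have -> : c = clamp 1 ((t - w) / (1 - w)).
    by rewrite /c uE; congr (clamp 1 _); field; nra.
  case: clampP => //; move: t01 => /andP[t0 t1].
  - rewrite pmulr_lle0 ?invr_gt0 ?subr_gt0// => tw; lra.
  - have -> : dl * ((t - w) / (1 - w)) = w * (t - w) by rewrite /dl; field; lra.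
    by rewrite /dl => _ _; nra.
  - by rewrite ler_pdivlMr ?subr_gt0//; lra.
have piece1 t : 0 <= t <= 1 ->
    a (1 + t) = 1 - dl * (1 - t) /\ b (1 + t) = s - (s - u) * t - kap * (1 - t).
  move=> t01; have [zb zs] := zigzag_piece1 s u t01; rewrite /b.
  have -> : a (1 + t) = 1 - dl * (1 - t).
    rewrite /a zb zs ffall; last by move: t01 => /andP[t0 t1]; nra.
    rewrite (_ : (_ - u) / _ = 1 - t); last by field; lra.
    by rewrite clamp_id//; lra.
  split=> //; rewrite zs krise; last by move: t01 => /andP[t0 t1]; nra.
  by rewrite -muE; ring.
have piece2 t (c := clamp 1 (s * t / (s - u))) : 0 <= t <= 1 ->
    a (2 + t) = 1 + (t - dl * c) /\ b (2 + t) = u + s * t - lam * (t - dl * c).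
  move=> t01; have [zb zs] := zigzag_piece2 s u t01; rewrite /b.
  have -> : a (2 + t) = 1 + (t - dl * c).
    rewrite /a zb zs ffall; last by move: t01 => /andP[t0 t1]; nra.
    by rewrite -/c [u + _]addrC addrK addrA.
  split=> //; rewrite zs [1 + _]addrC kp kfall//.
  have -> : c = clamp 1 (t / (1 - w)).
    by rewrite /c uE; congr (clamp 1 _); field; nra.
  case: clampP => //; move: t01 => /andP[t0 t1].
  - rewrite pmulr_lle0 ?invr_gt0 ?subr_gt0// => tw; lra.
  - have -> : dl * (t / (1 - w)) = w * t by rewrite /dl; field; lra.
    by rewrite /dl => _ _; nra.
  - by rewrite ler_pdivlMr ?subr_gt0//; lra.
have piece3 t : 0 <= t <= 1 ->
    a (3 + t) = 2 - dl * (1 - t) /\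
    b (3 + t) = s + u + (1 - s - u) * t - kap * (1 - t).
  move=> t01; have [zb zs] := zigzag_piece3 s u t01; rewrite /b.
  have -> : a (3 + t) = 2 - dl * (1 - t).
    move: t01 => /andP[t0 t1]; rewrite /a zb zs fE; last by nra.
    rewrite /gf clamp_high ?ler01 ?ler_pdivlMr//; last by nra.
    rewrite (_ : (_ - s - u) / _ = t); last by field; lra.
    by rewrite clamp_id//; lra.
  split=> //; rewrite zs (_ : 2 - _ = 1 - dl * (1 - t) + 1); last by ring.
  rewrite kp krise; last by move: t01 => /andP[t0 t1]; nra.
  by rewrite -muE; ring.
(* Here [b] is [(s - lam) * t] plus [lam * dl] times a nondecreasing clamp. *)
have inc0 : increasing_on b 0 1.
  move=> x y x0 xy y1.
  have [|_ ->] := piece0 x; first by lra.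
  have [|_ ->] := piece0 y; first by lra.
  have := @clamp_le 1 ((s * x - u) / (s - u)) ((s * y - u) / (s - u)).
  set c := clamp _ _; set c' := clamp _ _ => cc.
  have {}cc : c <= c'.
    by apply: cc => //; rewrite ler_pM2r ?invr_gt0// lerD2r ler_pM2l// ltW.
  have : lam * dl * c <= lam * dl * c' by rewrite ler_pM2l// mulr_gt0.
  have : (s - lam) * x < (s - lam) * y by rewrite ltr_pM2l// subr_gt0.
  by lra.
(* The slope is [kap - (s - u)], which is positive. *)
have inc1 : increasing_on b 1 2.
  move=> x y x0 xy y1; rewrite -(subrK 1 x) -(subrK 1 y) ![_ - 1 + 1]addrC.
  have [|_ ->] := piece1 (x - 1); first by lra.
  have [|_ ->] := piece1 (y - 1); first by lra.
  by nra.
have inc2 : increasing_on b 2 3.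
  move=> x y x0 xy y1; rewrite -(subrK 2 x) -(subrK 2 y) ![_ - 2 + 2]addrC.
  have [|_ ->] := piece2 (x - 2); first by lra.
  have [|_ ->] := piece2 (y - 2); first by lra.
  have := @clamp_le 1 (s * (x - 2) / (s - u)) (s * (y - 2) / (s - u)).
  set c := clamp _ _; set c' := clamp _ _ => cc.
  have {}cc : c <= c'.
    by apply: cc => //; rewrite ler_pM2r ?invr_gt0// ler_pM2l// lerD2r ltW.
  have : lam * dl * c <= lam * dl * c' by rewrite ler_pM2l// mulr_gt0.
  have : (s - lam) * x < (s - lam) * y by rewrite ltr_pM2l// subr_gt0.
  by lra.
have inc3 : increasing_on b 3 4.
  move=> x y x0 xy y1; rewrite -(subrK 3 x) -(subrK 3 y) ![_ - 3 + 3]addrC.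
  have [|_ ->] := piece3 (x - 3); first by lra.
  have [|_ ->] := piece3 (y - 3); first by lra.
  by nra.
have inc := increasing_glue (increasing_glue inc0 inc1) (increasing_glue inc2 inc3).
have czb := continuous_zigzag_b; have czs := @continuous_zigzag_s s u.
have ca : continuous a.
  by apply: continuous_add => //; exact: (continuous_compose cf czs).
have cb : continuous b.
  by apply: continuous_add => //; exact: (continuous_compose ck ca).
have c0 : clamp 1 ((s * 0 - u) / (s - u)) = 0.
  by rewrite clamp_low ?ler01// pmulr_lle0 ?invr_gt0//; lra.
have [|a0 b0] := piece0 0; first by lra.
have [|a4 b4] := piece3 1; first by lra.
have n4 : 3 + 1 = 4 :> R by ring.
rewrite c0 in a0 b0; rewrite n4 in a4 b4.
have a00 : a 0 = 0 by rewrite a0 mulr0 subr0.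
have b00 : b 0 = 0 by rewrite b0 !mulr0 subr0 mulr0 subr0.
have a42 : a 4 = 2 by rewrite a4 subrr mulr0 subr0.
have b41 : b 4 = 1 by rewrite b4; ring.
have [] := graph_function (ltr0n R 4) ca cb inc b00 b41 a00 a42.
move=> surj [h [ch hp hE]]; exists f, k, h; split=> //.
by move=> t t4; rewrite -/(a t) -/(b t) hE//; ring.
Qed.

End Straighten.

(** * Pinch moves on T(p, p m + 1) *)


Section Pinch.
Variables (R : realType) (p m : nat).
Hypothesis p2 : (2 <= p)%N.
Let q := (p * m + 1)%N.

Let qE : q%:R = p%:R * m%:R + 1 :> R.
Proof. by rewrite /q natrD natrM. Qed.

Let p2R : 2 <= p%:R :> R.
Proof. by rewrite (ler_nat R 2 p). Qed.

(* Coordinates on the torus in which T(p,q), q = p m + 1, is the circle [b = 0]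
   and T(p-2,q-2m) is the image of the line [b = 2 s]. *)
Definition tau (b s : R) : R4 R :=
  torus (s * p%:R - b, s * q%:R - b * m%:R).

Lemma tauD_int b s (i j : int) : tau (b + i%:~R) (s + j%:~R) = tau b s.
Proof.
rewrite /tau -(torusD_int (s * p%:R - b) _ (j * p%:Z - i) (j * q%:Z - i * m%:Z)).
by congr (torus (_, _)); rewrite !rmorphB !rmorphM /= -!pmulrn; ring.
Qed.

(** The change of coordinates has integer entries and determinant p m - q = -1, so its inverse is
    integral as well. *)
Lemma tau_eq b s b' s' : tau b s = tau b' s' ->
  exists i j : int, b = b' + i%:~R /\ s = s' + j%:~R.
Proof.
move=> /torus_eq [i [j /= [e1 e2]]].
exists (p%:Z * j - q%:Z * i), (j - m%:Z * i).
rewrite !rmorphB !rmorphM /= -!pmulrn; rewrite qE in e2 *.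
have -> : j%:~R = s * (p%:R * m%:R + 1) - b * m%:R
     - (s' * (p%:R * m%:R + 1) - b' * m%:R) by rewrite e2; ring.
have -> : i%:~R = s * p%:R - b - (s' * p%:R - b') by rewrite e1; ring.
by split; ring.
Qed.

(** Changing s alone moves a point in the direction (p, q), and the invariant p y - q x of that
    circle action is b. *)
Lemma tau_shear_s (k B S : R -> R) (I : set R) :
  continuous k -> (forall x, k (x + 1) = k x) ->
  global_isotopic [set tau (B t) (S t) | t in I]
    [set tau (B t) (S t + k (B t)) | t in I].
Proof.
move=> ck kp; have := torus_shear p q
  [set (S t * p%:R - B t, S t * q%:R - B t * m%:R) | t in I] ck kp.
rewrite !image_comp; congr global_isotopic; apply: eq_imagel => t _ /=.
rewrite (_ : p%:R * _ - q%:R * _ = B t); last by rewrite qE; ring.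
by congr (torus (_, _)); rewrite ?qE; ring.
Qed.

(** Changing b alone moves a point in the direction - (1, m), whence the sign; the invariant y - m x
    of that action is s. *)
Lemma tau_shear_b (f B S : R -> R) (I : set R) :
  continuous f -> (forall x, f (x + 1) = f x) ->
  global_isotopic [set tau (B t) (S t) | t in I]
    [set tau (B t + f (S t)) (S t) | t in I].
Proof.
move=> cf fp; have := @torus_shear R 1 m (fun x => - f x)
  [set (S t * p%:R - B t, S t * q%:R - B t * m%:R) | t in I]
  (continuous_opp cf) (fun x => congr1 -%R (fp x)).
rewrite !image_comp; congr global_isotopic; apply: eq_imagel => t _ /=.
rewrite (_ : _ - _ * (_ - _) = S t); last by rewrite qE; ring.
by congr (torus (_, _)); ring.
Qed.

Lemma tau_line : [set tau (2 * x) x | x in [set: R]] = torus_knot R (p - 2) (q - 2 * m).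
Proof.
apply: eq_imagel => x _; rewrite /tau; congr (torus (_, _)).
  by rewrite natrB//; ring.
rewrite natrB; last by rewrite /q addn1 leqW// leq_mul2r p2 orbT.
by rewrite natrM; ring.
Qed.

Lemma zigzag_isotopic (e s u : R) : 0 < u -> u < s -> s + u < 1 ->
  global_isotopic
    [set tau (zigzag_b t) (e + zigzag_s s u t) | t in `[0, 4]%classic]
    (torus_knot R (p - 2) (q - 2 * m)).
Proof.
move=> u0 us su.
have [f [k [h [[cf ck ch] [fp kp hp] line surj]]]] := zigzag_straighten u0 us su.
(* The line b = 2 s closes up when s grows by 1, so the values of s in [0, 1] reached by the
   straightened zigzag cover it. *)
have -> : torus_knot R (p - 2) (q - 2 * m) =
  [set tau (2 * (zigzag_s s u t + k (zigzag_b t + f (zigzag_s s u t))))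
     (zigzag_s s u t + k (zigzag_b t + f (zigzag_s s u t))) | t in `[0, 4]%classic].
  rewrite -tau_line; apply/seteqP; split=> _ [t ti <-]; last by eexists.
  have /andP[ft tf] := floor_itv t; rewrite rmorphD /= in tf.
  have [|r r4 rE] := surj (t - (Num.floor t)%:~R); first by lra.
  exists r; first by rewrite /= in_itv.
  rewrite rE -(tauD_int _ _ (2 * Num.floor t) (Num.floor t)) rmorphM /=.
  by congr tau; ring.
(* A constant shear slides the base point [e] to 0. *)
apply: (@global_isotopic_trans _ _
  [set tau (zigzag_b t) (zigzag_s s u t) | t in `[0, 4]%classic]).
  have := @tau_shear_s (fun=> - e) (@zigzag_b R) (fun t => e + zigzag_s s u t)
    `[0, 4]%classic (@continuous_const _ _ _) (fun=> erefl).
  by congr global_isotopic; apply: eq_imagel => t _; rewrite addrAC subrr add0r.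
apply: global_isotopic_trans (tau_shear_b _ _ _ cf fp) _.
apply: global_isotopic_trans (tau_shear_s _ _ _ ck kp) _.
have := @tau_shear_b h (fun t => zigzag_b t + f (zigzag_s s u t))
  (fun t => zigzag_s s u t + k (zigzag_b t + f (zigzag_s s u t))) `[0, 4]%classic ch hp.
congr global_isotopic; apply: eq_imagel => t; rewrite /= in_itv /= => t4.
by rewrite line.
Qed.

Lemma int_gap (k : int) (x : R) : x = k%:~R -> 0 < x -> x < 1 -> False.
Proof. by move=> ->; rewrite ltr0z ltrz1; lia. Qed.

Lemma torus_knot_tau t : torus (p%:R * t, q%:R * t) = tau 0 t.
Proof. by rewrite /tau; congr (torus (_, _)); ring. Qed.

Lemma torus_knot_tauP b s : torus_knot R p q (tau b s) <-> exists i : int, b = i%:~R.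
Proof.
split=> [[t _]|[i ->]].
  rewrite torus_knot_tau => /esym/tau_eq[i [j [-> _]]].
  by exists i; rewrite add0r.
exists s => //; rewrite torus_knot_tau -(tauD_int 0 s i 0).
by rewrite add0r addr0.
Qed.

Lemma tauD1 b s : tau (1 + b) s = tau b s.
Proof. by rewrite -[RHS](tauD_int _ _ 1 0) addr0 addrC. Qed.

Lemma tauD1s b s : tau b (s + 1) = tau b s.
Proof. by rewrite -[RHS](tauD_int _ _ 0 1) addr0. Qed.

(** The core direction is (s p - 1, s q - m), so [0 <= d.2] gives [0 <= s] and [d.1 <= 0] gives
    [p s <= 1], hence [s <= 1/2]. The b-coordinate of the base point is an integer because that
    corner lies on the knot. *)
Lemma pinch_band_tau b : pinch_band p q b ->
  exists e s u : R, [/\ 0 < u, u < s, s <= 2^-1 &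
    forall x, unit_square R x -> b x = tau x.1 (e + x.1 * s + x.2 * u)].
Proof.
move=> [[_ binj _ bK] [c [d [u [dE [d1 d2] u0 bE]]]]].
pose s := d.2 - m%:R * d.1; pose bc := p%:R * c.2 - q%:R * c.1.
pose e := c.2 - m%:R * c.1.
have {dE} dE : p%:R * d.2 - (p%:R * m%:R + 1) * d.1 = 1 by rewrite -qE.
have d1E : d.1 = s * p%:R - 1.
  transitivity (s * p%:R - (p%:R * d.2 - (p%:R * m%:R + 1) * d.1)); last by rewrite dE.
  by rewrite /s; ring.
have d2E : d.2 = s * q%:R - m%:R.
  rewrite qE; transitivity (s * (p%:R * m%:R + 1)
    - m%:R * (p%:R * d.2 - (p%:R * m%:R + 1) * d.1)); last by rewrite dE mulr1.
  by rewrite /s; ring.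
have {}bE x : unit_square R x -> b x = tau (bc + x.1) (e + x.1 * s + x.2 * u).
  move=> xI; rewrite bE//; congr (torus (_, _)).
    by rewrite d1E /e /bc qE; ring.
  by rewrite d2E /e /bc qE; ring.
have in00 : unit_square R (0, 0) by split; rewrite /= in_itv /= lexx ler01.
have [i bci] : exists i : int, bc = i%:~R.
  have : torus_knot R p q (b (0, 0)) by apply/(bK _ in00); left.
  by rewrite bE//= addr0 => /torus_knot_tauP.
have {}bE x : unit_square R x -> b x = tau x.1 (e + x.1 * s + x.2 * u).
  move=> xI; rewrite bE// bci -(tauD_int x.1 _ i 0) addr0.
  by rewrite [x.1 + _]addrC.
have s0 : 0 <= s.
  have m0 : 0 <= m%:R :> R by rewrite ler0n.
  have q0 : 0 < q%:R :> R by rewrite /q ltr0n addn1.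
  by rewrite -(pmulr_lge0 _ q0); lra.
have s2 : s <= 2^-1.
  by have : 2 * s <= p%:R * s; [exact: ler_wpM2r|lra].
exists e, s, u; split=> //.
(* If [s <= u], the corner (1, 0) would land on the opposite end of the band, at (0, s / u), against
   injectivity. *)
rewrite ltNge; apply/negP => su.
have x1 : unit_square R (0, s / u).
  split; rewrite /= in_itv /= ?lexx ?ler01//.
  by rewrite divr_ge0 ?(ltW u0)//= ler_pdivrMr// mul1r.
have x2 : unit_square R (1, 0) by split; rewrite /= in_itv /= ?lexx ?ler01.
have /binj : b (0, s / u) = b (1, 0).
  rewrite !bE//= mulfVK ?gt_eqF// -[in RHS](addr0 1) tauD1.
  by congr tau; ring.
by rewrite !inE => /(_ x1 x2) [] /esym/eqP; rewrite oner_eq0.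
Qed.

(** Measured from [e] along the knot, a circle of length 1, the ends of the band cover [0, u] and
    [s, s + u], which are disjoint. Removing them leaves the arcs (u, s) and (s + u, 1), which the
    edges of the band join into the zigzag. *)
Lemma band_surgery_zigzag (b : R * R -> R4 R) (e s u : R) :
  0 < u -> u < s -> s + u < 1 ->
  (forall x, unit_square R x -> b x = tau x.1 (e + x.1 * s + x.2 * u)) ->
  band_surgery (torus_knot R p q) b =
  [set tau (zigzag_b t) (e + zigzag_s s u t) | t in `[0, 4]%classic].
Proof.
move=> u0 us su bE.
have b0E y : 0 <= y <= 1 -> b (0, y) = tau 0 (e + y * u).
  move=> yI; rewrite bE; last by split; rewrite /= in_itv /= ?lexx ?ler01.
  by congr tau => /=; ring.
have b1E y : 0 <= y <= 1 -> b (1, y) = tau 0 (e + s + y * u).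
  move=> yI; rewrite bE; last by split; rewrite /= in_itv /= ?lexx ?ler01.
  by rewrite -{1}(addr0 1) tauD1; congr tau => /=; ring.
have bl y : 0 <= y <= 1 -> b (y, 0) = tau y (e + y * s).
  move=> yI; rewrite bE; last by split; rewrite /= in_itv /= ?lexx ?ler01.
  by congr tau => /=; ring.
have br y : 0 <= y <= 1 -> b (y, 1) = tau y (e + y * s + u).
  move=> yI; rewrite bE; last by split; rewrite /= in_itv /= ?lexx ?ler01.
  by congr tau => /=; ring.
have sides x y : x = 0 \/ x = 1 -> 0 <= y <= 1 ->
    (b @` (`[0, 1]%classic `*` [set 0; 1])) (b (y, x)).
  by move=> x01 yI; exists (y, x) => //; split; rewrite /= ?in_itv.
have arc r : u < r -> r < 1 -> r < s \/ s + u < r ->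
    (torus_knot R p q `\` b @` ([set 0; 1] `*` `[0, 1]%classic)) (tau 0 (e + r)).
  move=> ur r1 rs; split; first by apply/torus_knot_tauP; exists 0.
  move=> [[x y] [/= x01]]; rewrite in_itv /= => yI.
  have yu : 0 <= y * u <= u.
    by move: yI => /andP[y0 y1]; rewrite mulr_ge0 ?(ltW u0)//= ger_pMl.
  case: x01 => ->; rewrite ?b0E ?b1E// => /tau_eq[_ [j [_ jE]]].
    by apply: (@int_gap (- j) (r - y * u)); rewrite ?rmorphN /=; lra.
  case: rs => rs.
    by apply: (@int_gap j (s + y * u - r)); lra.
  by apply: (@int_gap (- j) (r - s - y * u)); rewrite ?rmorphN /=; lra.
apply/seteqP; split=> z.
- move=> [[[y _ <-] nb]|].
    rewrite torus_knot_tau in nb *.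
    have /andP[fl lf] := floor_itv (y - e); rewrite rmorphD /= in lf.
    set n := Num.floor (y - e) in fl lf; pose r := y - e - n%:~R.
    have yE : tau 0 y = tau 0 (e + r).
      by rewrite -[RHS](tauD_int _ _ 0 n) /r addr0; congr tau; ring.
    have r0 : 0 <= r by rewrite /r; lra.
    have r1 : r < 1 by rewrite /r; lra.
    have nstrip (x t : R) : x = 0 \/ x = 1 -> 0 <= t <= 1 -> b (x, t) = tau 0 y -> False.
      by move=> x01 tI bt; apply: nb; exists (x, t).
    have [ru|ur] := leP r u.
      have ru1 : 0 <= r / u <= 1 by rewrite divr_ge0 ?(ltW u0)//= ler_pdivrMr// mul1r.
      exfalso; apply: (nstrip 0 (r / u)); [by left|by []|].
      by rewrite b0E// mulfVK ?gt_eqF// yE.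
    have [rs|sr] := ltP r s.
      pose t := (s - r) / (s - u).
      have su0 : 0 < s - u by rewrite subr_gt0.
      have tI : 0 <= t <= 1.
        by rewrite /t divr_ge0 ?ler_pdivrMr//=; lra.
      have [zb zs] := zigzag_piece1 s u tI.
      exists (1 + t); first by rewrite /= in_itv /=; lra.
      rewrite zb zs /t mulrC mulfVK ?gt_eqF// yE -[in LHS](addr0 1) tauD1.
      by congr tau; ring.
    have [rsu|sur] := leP r (s + u).
      have ru1 : 0 <= (r - s) / u <= 1.
        by rewrite divr_ge0 ?subr_ge0 ?(ltW u0)//= ler_pdivrMr// mul1r lerBlDl.
      exfalso; apply: (nstrip 1 ((r - s) / u)); [by right|by []|].
      by rewrite b1E// mulfVK ?gt_eqF// yE; congr tau; ring.
    pose t := (r - s - u) / (1 - s - u).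
    have d0 : 0 < 1 - s - u by lra.
    have tI : 0 <= t <= 1.
      by rewrite /t divr_ge0 ?(ltW d0)//= ?ler_pdivrMr//; lra.
    have [zb zs] := zigzag_piece3 s u tI.
    exists (3 + t); first by rewrite /= in_itv /=; lra.
    rewrite zb zs /t mulrC mulfVK ?gt_eqF// yE.
    rewrite (_ : 2 = 1 + (1 + 0)); last by ring.
    by rewrite !tauD1; congr tau; ring.
  move=> [[y x] [/= ]]; rewrite in_itv /= => yI x01 <-.
  case: x01 => ->.
    have [zb zs] := zigzag_piece0 s u yI.
    exists y; first by rewrite /= in_itv /=; lra.
    by rewrite zb zs bl// mulrC.
  have [zb zs] := zigzag_piece2 s u yI.
  exists (2 + y); first by rewrite /= in_itv /=; lra.
  by rewrite zb zs br// tauD1; congr tau; ring.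
- move=> [t]; rewrite /= in_itv /= => /andP[t0 t4] <-.
  have [t1|t1] := leP t 1.
    have tI : 0 <= t <= 1 by rewrite t0.
    have [-> ->] := zigzag_piece0 s u tI.
    by right; rewrite mulrC -bl//; apply: sides => //; left.
  have [t2|t2] := leP t 2.
    have tI : 0 <= t - 1 <= 1 by lra.
    have := zigzag_piece1 s u tI; rewrite (_ : 1 + (t - 1) = t); last by ring.
    move=> [-> ->]; rewrite -{1}(addr0 1) tauD1.
    (* The last point of this piece was removed with the end of the band, but is restored as the
       corner (0, 1) of an edge; likewise [t = 4] below gives the corner (0, 0). *)
    have [/eqP t3|t3] := boolP (t == 2).
      right; have := sides 1 0; rewrite b0E ?lexx ?ler01//.
      by rewrite t3 (_ : s - _ = 1 * u); [apply; [right|lra]|ring].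
    left; have t3' : t < 2 by rewrite lt_neqAle t3.
    by apply: arc; [nra|nra|left; nra].
  have [t3|t3] := leP t 3.
    have tI : 0 <= t - 2 <= 1 by lra.
    have := zigzag_piece2 s u tI; rewrite (_ : 2 + (t - 2) = t); last by ring.
    move=> [-> ->]; rewrite tauD1; right.
    rewrite (_ : e + _ = e + (t - 2) * s + u); last by ring.
    by rewrite -br//; apply: sides => //; right.
  have tI : 0 <= t - 3 <= 1 by lra.
  have := zigzag_piece3 s u tI; rewrite (_ : 3 + (t - 3) = t); last by ring.
  move=> [-> ->]; rewrite (_ : 2 = 1 + (1 + 0)); last by ring.
  rewrite !tauD1.
  have [/eqP t5|t5] := boolP (t == 4).
    right; have := sides 0 0; rewrite bl ?lexx ?ler01// mul0r addr0.
    rewrite t5 (_ : e + (_ + _) = e + 1); last by ring.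
    by rewrite tauD1s; apply; [left|lra].
  left; have t5' : t < 4 by rewrite lt_neqAle t5.
  by apply: arc; [nra|nra|right; nra].
Qed.

Lemma pinch_band_exists : exists b : R * R -> R4 R, pinch_band p q b.
Proof.
(* With [s = 1 / p] the core direction is (0, 1 / p), parallel to a coordinate circle of the torus;
   half of [s] is a safe width. *)
pose s : R := p%:R^-1; have [u uE] : exists u, u = s / 2 by exists (s / 2).
have p0 : 0 < p%:R :> R by have := p2R; lra.
have sp : s * p%:R = 1 by rewrite /s mulVf// gt_eqF.
have s0 : 0 < s by rewrite invr_gt0.
have s2 : s <= 2^-1 by rewrite lef_pV2// posrE.
have u0 : 0 < u by lra.
pose b (x : R * R) : R4 R := tau x.1 (x.1 * s + x.2 * u).
have I01 (x : R * R) : unit_square R x -> 0 <= x.1 <= 1 /\ 0 <= x.2 <= 1.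
  by move=> [] /=; rewrite !in_itv.
have xu y : 0 <= y <= 1 -> 0 <= y * u <= u.
  by move=> /andP[y0 y1]; rewrite mulr_ge0 ?(ltW u0)//= ger_pMl.
exists b; split.
  split.
  - apply: continuous_subspaceT; rewrite /b /tau /torus /=.
    by cont.
  - move=> x y; rewrite !inE => /I01[x1 x2] /I01[y1 y2] /tau_eq[i [j [e1 e2]]].
    have := xu _ x2; have := xu _ y2 => yu' xu'.
    have x1y1 : x.1 = y.1.
      apply/eqP; apply: contraT => xy.
      have [xy'|xy'] : x.1 < y.1 \/ y.1 < x.1 by apply/orP; rewrite -neq_lt.
        have [xy1|xy1] := ltP (y.1 - x.1) 1.
          by exfalso; apply: (@int_gap (- i) (y.1 - x.1)); rewrite ?rmorphN /=; lra.
        have x0 : x.1 = 0 by lra.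
        have y0 : y.1 = 1 by lra.
        rewrite x0 y0 in e2.
        by exfalso; apply: (@int_gap (- j) (s + y.2 * u - x.2 * u));
          rewrite ?rmorphN /=; lra.
      have [xy1|xy1] := ltP (x.1 - y.1) 1.
        by exfalso; apply: (@int_gap i (x.1 - y.1)); lra.
      have x0 : x.1 = 1 by lra.
      have y0 : y.1 = 0 by lra.
      rewrite x0 y0 in e2.
      by exfalso; apply: (@int_gap j (s + x.2 * u - y.2 * u)); lra.
    have x2y2 : x.2 * u = y.2 * u.
      apply/eqP; apply: contraT => xy; exfalso.
      rewrite x1y1 in e2.
      have [xy'|xy'] : x.2 * u < y.2 * u \/ y.2 * u < x.2 * u by apply/orP; rewrite -neq_lt.
        by apply: (@int_gap (- j) (y.2 * u - x.2 * u)); rewrite ?rmorphN /=; lra.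
      by apply: (@int_gap j (x.2 * u - y.2 * u)); lra.
    move/(mulIf (lt0r_neq0 u0)): x2y2.
    by case: x x1y1 {x1 x2 e1 e2 xu'} => ? ?; case: y {y1 y2 yu'} => ? ? /= -> ->.
  - by move=> _ [x _ <-]; exact: S3_torus.
  - move=> x /I01[x1 x2]; split=> [/torus_knot_tauP[i xi]|x01]; last first.
      by apply/torus_knot_tauP; case: x01 => ->; [exists 0|exists 1].
    have [x0|x0] := leP x.1 0; first by left; lra.
    have [x1'|x1'] := leP 1 x.1; first by right; lra.
    by exfalso; apply: (int_gap xi).
exists (0, 0), (0, s), u; split=> //=.
- by rewrite mulr0 subr0 mulrC.
- by split=> //; exact: ltW.
move=> x _; rewrite /b /tau qE; congr (torus (_, _)).
  by rewrite [in RHS]mulr0 addr0 add0r mulrDl -mulrA sp mulr1; ring.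
have -> : (x.1 * s + x.2 * u) * (p%:R * m%:R + 1) - x.1 * m%:R =
  x.1 * m%:R * (s * p%:R - 1) + x.1 * s + x.2 * (u * (p%:R * m%:R + 1)) by ring.
by rewrite sp subrr mulr0 !add0r.
Qed.

Lemma pinch_move_torus_knot :
  pinch_move (torus_knot R p q) (torus_knot R (p - 2) (q - 2 * m)).
Proof.
exists p, q; split.
- by rewrite /coprime /q mulnC gcdnMDl gcdn1.
- by apply: ambient_isotopic_refl => _ [t _ <-]; exact: S3_torus.
- exact: pinch_band_exists.
- move=> b pb; have [e [s [u [u0 us s2 bE]]]] := pinch_band_tau pb.
  (* From [u < s <= 1/2]: the two ends of the band do not meet around the knot. *)
  have su : s + u < 1 by lra.
  have sE := band_surgery_zigzag u0 us su bE.
  apply: global_isotopic_ambient; last by rewrite sE; exact: zigzag_isotopic.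
  by rewrite sE => _ [t _ <-]; exact: S3_torus.
Qed.

End Pinch.

Theorem corollary3p4 (R : realType) (n : nat) (hn : (2 <= n)%N) :
  exists L1 L2 L3 : set (R4 R),
    [/\ pinch_move (J_knot R n) L1,
        pinch_move L1 L2,
        pinch_move L2 L3 &
        pinch_move L3 (K_knot R (n - 2))].
Proof.
(* Each move lowers p by 2 and q by 2 (n - 1), so q = p (n - 1) + 1 persists. After four moves p = 4
   (n - 2) and q = (4 n - 8) (n - 1) + 1 = (2 n - 3)^2. *)
pose T i := torus_knot R (4 * n - 2 * i) ((4 * n - 2 * i) * (n - 1) + 1).
have step i : (i < 4)%N -> pinch_move (T i) (T i.+1).
  (* The tightest case is n = 2, i = 3, where the last move goes from p = 2 to the unknot T(0,
     1). *)
  move=> i4; have p2 : (2 <= 4 * n - 2 * i)%N by lia.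
  have := pinch_move_torus_knot R (n - 1) p2.
  by rewrite /T; congr (pinch_move _ (torus_knot R _ _)); nia.
have -> : J_knot R n = T 0 by congr (torus_knot R _ _); nia.
have -> : K_knot R (n - 2) = T 4 by congr (torus_knot R _ _); nia.
by exists (T 1), (T 2), (T 3); split; exact: step.
Qed.
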